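(* Fix vectors $x,z \in \mathbb{R}^n$ and a probability measure $\mu$ on $S^{n-1}$. Let $P = P_\mu$ be the generalized Kaczmarz projection with respect to $\mu$ (with target $x$), and let $W_{x,z} := \{v\in S^{n-1} : \operatorname{sign}(\langle v,x\rangle)\ne\operatorname{sign}(\langle v,z\rangle)\}$. Then $$\mathbb{E}\|Pz-x\|_2^2 \leq \left[1 -\lambda_{\min}\left(\mathbb{E}\, aa^T-4\,\mathbb{E}\, aa^T1_{W_{x,z}}(a)\right)\right]\|z-x\|_2^2,$$ where $a\sim\mu$.
   Context: The generalized Kaczmarz projection with respect to a probability measure $\mu$ on $S^{n-1}$, with target $x\in\mathbb{R}^n$, is the random map on $\mathbb{R}^n$ given by $Pz := z+\eta a$, where $a\sim\mu$ and $\eta = \operatorname{sign}(\langle a,z\rangle)|\langle a,x\rangle| - \langle a,z\rangle$. $\operatorname{sign}$ is the usual sign function and $\lambda_{\min}$ denotes the smallest eigenvalue of a symmetric matrix. *)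

(* Defs.v *)
From HB Require Import structures.
From mathcomp Require Import all_boot all_order all_algebra.
From mathcomp Require Import all_classical all_reals all_analysis.
Import Order.TTheory GRing.Theory Num.Theory.
Import numFieldNormedType.Exports.

Set Implicit Arguments.
Unset Strict Implicit.
Unset Printing Implicit Defensive.

Local Open Scope classical_set_scope.
Local Open Scope ring_scope.

(* R^n with its Borel sigma-algebra. *)
Notation borel_space R n := (g_sigma_algebraType (@open 'cV[R]_n)).

Definition dot (R : realType) (n : nat) (u v : 'cV[R]_n) : R :=
  (u^T *m v) 0 0.

(* The library norm `|u| on matrices is the max norm, hence this one. *)
Definition norm2 (R : realType) (n : nat) (u : 'cV[R]_n) : R :=
  Num.sqrt (dot u u).

Definition sphere (R : realType) (n : nat) : set 'cV[R]_n :=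
  [set v | norm2 v = 1].

(* The realization of the random map P with target x at the direction a;
   Num.sg 0 = 0. *)
Definition kaczmarz_step (R : realType) (n : nat) (x a z : 'cV[R]_n) : R :=
  Num.sg (dot a z) * `|dot a x| - dot a z.

Definition kaczmarz (R : realType) (n : nat) (x a z : 'cV[R]_n) : 'cV[R]_n :=
  z + kaczmarz_step x a z *: a.

Definition wedge (R : realType) (n : nat) (x z : 'cV[R]_n) : set 'cV[R]_n :=
  [set v | sphere v /\ Num.sg (dot v x) <> Num.sg (dot v z)].

(* Entrywise expectation of a random matrix. It is meaningful when the entries
   are integrable, e.g. bounded mu-almost everywhere; otherwise fine sends an
   infinite expectation to 0. *)
Definition expectation_mx (R : realType) (n p q : nat)
    (mu : probability (borel_space R n) R) (M : 'cV[R]_n -> 'M[R]_(p, q)) :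
    'M[R]_(p, q) :=
  \matrix_(i, j) fine ('E_mu[fun a => M a i j])%E.

(* The spectrum is finite, and nonempty when A is symmetric and n > 0, so that
   the infimum is then a minimum. *)
Definition lambda_min (R : realType) (n : nat) (A : 'M[R]_n) : R :=
  inf [set l : R | eigenvalue A l].

(* Main.v *)
Require Import Defs.
From mathcomp Require Import all_boot all_order all_algebra.
From mathcomp Require Import all_classical all_reals all_analysis.
From mathcomp Require Import measurable_realfun ring lra.
Import Order.TTheory GRing.Theory Num.Theory.
Import numFieldNormedType.Exports.
Local Open Scope classical_set_scope.
Local Open Scope ring_scope.

(** Write d := z - x, p := <a,x>, q := <a,z> and t := sign(q)|p| - q. Since a is
a unit vector and <a,d> = q - p,
[[
  |Pz - x|^2 = |d|^2 + 2 t (q - p) + t^2 .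
]]
When sign p = sign q, the step is t = p - q and the right-hand side is
|d|^2 - (q - p)^2: the ordinary Kaczmarz projection. When the signs differ,
p q <= 0, so |q - p| = |p| + |q| is large enough that even a step in the wrong
direction satisfies 2 t (q - p) + t^2 <= 3 (q - p)^2. Both cases are contained in
[[
  |Pz - x|^2 <= |d|^2 - <a,d>^2 + 4 1_W(a) <a,d>^2 ,
]]
which is [sqr_norm2_kaczmarz_le]. The quadratic form of an expectation is the
expectation of the quadratic form ([dot_expectation_mx]), so integrating this
bound over the sphere, which carries all the mass of mu, gives
E |Pz - x|^2 <= |d|^2 - <d, A d> with A := E aa^T - 4 E aa^T 1_W.

It remains to bound <d, A d> below by lambda_min(A) |d|^2 for the symmetric
real matrix A ([lambda_min_quad_le]). No diagonalization is used: the minimum m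
of the quadratic form on the compact unit sphere is attained at some c, the
matrix A - m is positive semidefinite and c is isotropic for it, hence in its
kernel ([psd_isotropic_ker]), so that m is an eigenvalue. *)

(** * The Euclidean inner product *)

Section Dot.
Context {R : realType} {n : nat}.
Implicit Types (u v w a x : 'cV[R]_n) (A : 'M[R]_n).

Lemma dotE u v : dot u v = \sum_i u i 0 * v i 0.
Proof. by rewrite /dot mxE; apply: eq_bigr => i _; rewrite mxE. Qed.

Lemma dotC u v : dot u v = dot v u.
Proof. by rewrite !dotE; apply: eq_bigr => i _; rewrite mulrC. Qed.

Lemma dotDr u v w : dot u (v + w) = dot u v + dot u w.
Proof. by rewrite /dot mulmxDr mxE. Qed.

Lemma dotZr k u v : dot u (k *: v) = k * dot u v.
Proof. by rewrite /dot -scalemxAr mxE. Qed.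

Lemma dotBr u v w : dot u (v - w) = dot u v - dot u w.
Proof. by rewrite dotDr -scaleN1r dotZr mulN1r. Qed.

Lemma dotDl u v w : dot (v + w) u = dot v u + dot w u.
Proof. by rewrite dotC dotDr !(dotC u). Qed.

Lemma dotZl k u v : dot (k *: u) v = k * dot u v.
Proof. by rewrite dotC dotZr dotC. Qed.

Lemma dot_mulmx A u v : dot u (A *m v) = dot (A^T *m u) v.
Proof. by rewrite /dot trmx_mul trmxK mulmxA. Qed.

Lemma dot_mulmxE A u : dot u (A *m u) = \sum_i \sum_j u i 0 * u j 0 * A i j.
Proof.
rewrite dotE; apply: eq_bigr => i _; rewrite mxE mulr_sumr.
by apply: eq_bigr => j _; ring.
Qed.

Lemma dot_outer a u : dot u (a *m a^T *m u) = dot a u ^+ 2.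
Proof. by rewrite -mulmxA /dot mulmxA mxE big_ord1 expr2 -!/(dot _ _) dotC. Qed.

Lemma sqr_entry_le_dot u i : u i 0 ^+ 2 <= dot u u.
Proof.
rewrite dotE (bigD1 i)//= expr2 lerDl sumr_ge0// => j _.
by rewrite -expr2 sqr_ge0.
Qed.

Lemma dot_ge0 u : 0 <= dot u u.
Proof. by rewrite dotE sumr_ge0// => j _; rewrite -expr2 sqr_ge0. Qed.

Lemma dot_eq0 u : (dot u u == 0) = (u == 0).
Proof.
apply/idP/eqP => [/eqP u0|->]; last by rewrite /dot mulmx0 mxE.
apply/colP => i; rewrite mxE; apply/eqP.
by rewrite -sqrf_eq0 eq_le sqr_ge0 andbT -u0 sqr_entry_le_dot.
Qed.

Lemma sqr_norm2 u : norm2 u ^+ 2 = dot u u.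
Proof. by rewrite sqr_sqrtr// dot_ge0. Qed.

Lemma sphereE : @sphere R n = [set u | dot u u = 1].
Proof.
apply/seteqP; split=> u /= u1; last by rewrite /sphere/= /norm2 u1 sqrtr1.
by rewrite -sqr_norm2 u1 expr1n.
Qed.

Lemma sphere_entry_le1 a i : sphere a -> `|a i 0| <= 1.
Proof.
rewrite sphereE /= => a1.
by rewrite -(ler_pXn2r (n := 2))// ?nnegrE// expr1n real_normK ?num_real// -a1
  sqr_entry_le_dot.
Qed.

End Dot.

(** * The Rayleigh bound for the smallest eigenvalue *)

Lemma sum_continuous {T : topologicalType} {R : realType} {I : Type}
    (r : seq I) (f : I -> T -> R) :
  (forall i, continuous (f i)) -> continuous (fun t => \sum_(i <- r) f i t).
Proof.
move=> fc; elim: r => [|i r IHr] t.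
  under eq_fun do rewrite big_nil; exact: cvg_cst.
under eq_fun do rewrite big_cons.
by apply: cvgD; [exact: fc|exact: IHr].
Qed.

Section Rayleigh.
Context {R : realType} {n : nat}.
Implicit Types (u v w : 'cV[R]_n) (A : 'M[R]_n).

(** The form is nonnegative at u + t A u for every t; at first order in t it
equals 2 t |A u|^2, which would be negative for small t < 0 if A u were
nonzero. *)
Lemma psd_isotropic_ker A u : A^T = A -> (forall w, 0 <= dot w (A *m w)) ->
  dot u (A *m u) = 0 -> A *m u = 0.
Proof.
move=> As Apos u0; apply/eqP; rewrite -dot_eq0; apply/eqP.
set w := A *m u; set p := dot w w; set k := dot w (A *m w).
have k0 : 0 <= k by exact: Apos.
have p0 : 0 <= p by exact: dot_ge0.
have exp t : 0 <= 2 * t * p + t ^+ 2 * k.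
  have := Apos (u + t *: w).
  rewrite mulmxDr !dotDl !dotDr u0 -scalemxAr !dotZl !dotZr.
  by rewrite (dot_mulmx A u) As -/w -/p -/k; congr (_ <= _); ring.
have k1 : k + 1 != 0 by rewrite gt_eqF// ltr_wpDl.
(* t = - p / k minimizes the bound; the + 1 covers the case k = 0. *)
have := exp (- p / (k + 1)).
have -> : 2 * (- p / (k + 1)) * p + (- p / (k + 1)) ^+ 2 * k
   = - (p / (k + 1)) ^+ 2 * (k + 2) by field.
rewrite mulNr oppr_ge0 => /(conj (sqr_ge0 (p / (k + 1)))) [q0 q1].
have q : (p / (k + 1)) ^+ 2 = 0 by nra.
by move/eqP: q; rewrite sqrf_eq0 mulf_eq0 invr_eq0 (negPf k1) orbF => /eqP.
Qed.

Lemma continuous_quad A : continuous (fun u : 'rV[R]_n => dot u^T (A *m u^T)).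
Proof.
have -> : (fun u : 'rV[R]_n => dot u^T (A *m u^T)) =
    (fun u : 'rV[R]_n => \sum_i \sum_j u 0 i * u 0 j * A i j).
  apply/funext => u; rewrite dot_mulmxE; apply: eq_bigr => i _.
  by apply: eq_bigr => j _; rewrite !mxE.
apply: sum_continuous => i; apply: sum_continuous => j u.
pose x k (v : 'rV[R]_n) := v 0 k.
have xc k : {for u, continuous (x k)} by exact: coord_continuous.
exact: (continuousM (continuousM (xc i) (xc j))
  (@cst_continuous _ _ (A i j) u)).
Qed.

(** Closed and bounded implies compact for row vectors, which are also the
shape of the eigenvectors of [eigenvalue]; hence the transposes. *)
Lemma compact_unit_sphere : compact [set u : 'rV[R]_n | dot u^T u^T = 1].
Proof.
apply: bounded_closed_compact.
  exists 1; split; first exact: num_real.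
  move=> M M1 u /= u1; rewrite [leLHS]mx_normrE.
  apply: bigmax_le => [|[i j] _ /=]; first exact: le_trans (ltW M1).
  rewrite ord1 (le_trans _ (ltW M1))//.
  have : sphere u^T by rewrite sphereE.
  by move/(sphere_entry_le1 _ j); rewrite mxE.
have -> : [set u : 'rV[R]_n | dot u^T u^T = 1] =
    (fun u : 'rV[R]_n => dot u^T (1%:M *m u^T)) @^-1` [set 1].
  by apply/seteqP; split => u /=; rewrite mul1mx.
apply: preimage_closed; first by move=> u _; exact: continuous_quad.
exact: accessible_closed_set1 (hausdorff_accessible (@Rhausdorff R)) _.
Qed.

(** The minimum m of the quadratic form on the unit sphere bounds every
eigenvalue from below, since an eigenvector realizes its eigenvalue as a
Rayleigh quotient, and is itself an eigenvalue; so [lambda_min A <= m], while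
m |u|^2 <= <u, A u> by homogeneity. *)
Lemma lambda_min_quad_le A u : A^T = A ->
  lambda_min A * dot u u <= dot u (A *m u).
Proof.
move=> As.
have [->|u0] := eqVneq u 0; first by rewrite mulmx0 /dot mulmx0 mxE mulr0.
pose S := [set v : 'rV[R]_n | dot v^T v^T = 1].
have toS v : v != 0 -> S ((Num.sqrt (dot v v))^-1 *: v^T).
  move=> v0; rewrite /S/= linearZ/= trmxK dotZl dotZr mulrA -expr2 exprVn.
  by rewrite sqr_sqrtr ?dot_ge0// mulVf// dot_eq0.
have [|c /[!inE] cS cmin] := @compact_EVT_min _ R
   (fun v : 'rV[R]_n => dot v^T (A *m v^T)) S _ compact_unit_sphere
   (continuous_subspaceT (continuous_quad A)).
  by exists ((Num.sqrt (dot u u))^-1 *: u^T); exact: toS.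
set m := dot c^T (A *m c^T) in cmin.
have minle v : m * dot v v <= dot v (A *m v).
  have [->|v0] := eqVneq v 0; first by rewrite mulmx0 /dot mulmx0 mxE mulr0.
  have := cmin _ (mem_set (toS _ v0)).
  rewrite linearZ/= trmxK -scalemxAr dotZl dotZr mulrA -expr2 exprVn.
  rewrite sqr_sqrtr ?dot_ge0// mulrC ler_pdivlMr//.
  by rewrite lt_def dot_eq0 v0 dot_ge0.
apply: le_trans (minle u); rewrite ler_wpM2r ?dot_ge0//.
(* The infimum of a set lies below its members only if the set is bounded from
   below, which [m] itself guarantees for the spectrum. *)
apply: ge_inf => /=.
  exists m => l /= /eigenvalueP[v vA v0].
  have := minle v^T.
  have -> : A *m v^T = l *: v^T by rewrite -{1}As -trmx_mul vA linearZ.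
  by rewrite dotZr ler_pM2r// lt_def dot_ge0 dot_eq0 trmx_eq0 v0.
apply/eigenvalueP; exists c; last first.
  rewrite -trmx_eq0 -dot_eq0; move: cS; rewrite /S /= => ->; exact: oner_neq0.
have Bc : (A - m%:M) *m c^T = 0.
  apply: psd_isotropic_ker => [|w|].
  - by rewrite linearB/= As tr_scalar_mx.
  - by rewrite mulmxBl mul_scalar_mx dotBr dotZr subr_ge0.
  - by rewrite mulmxBl mul_scalar_mx dotBr dotZr cS mulr1 subrr.
move/(congr1 trmx): Bc; rewrite trmx0 trmx_mul trmxK linearB/= As tr_scalar_mx.
by rewrite mulmxBr mul_mx_scalar => /eqP; rewrite subr_eq0 => /eqP.
Qed.

End Rayleigh.

(** * One step in a fixed direction *)

Section Pointwise.
Context {R : realType} {n : nat}.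
Implicit Types a x z : 'cV[R]_n.

Lemma sqr_norm2_kaczmarz a x z : sphere a ->
  norm2 (kaczmarz x a z - x) ^+ 2 =
  norm2 (z - x) ^+ 2 + 2 * kaczmarz_step x a z * dot a (z - x)
  + kaczmarz_step x a z ^+ 2.
Proof.
rewrite sphereE /= => a1; rewrite !sqr_norm2 /kaczmarz addrAC.
rewrite !dotDl !dotDr !dotZl !dotZr a1.
rewrite !(dotC z a) !(dotC _ a); ring.
Qed.

(** The scalar inequality behind the factor 4, with t := sign(q)|p| - q. For equal
signs t = p - q and it is an
equality. If the signs differ and q <> 0, then t = - p - q and the gap
between the two sides is 4 q^2 - 8 p q, nonnegative because p q <= 0; if
q = 0 there is no step at all. *)
Lemma sg_step_le (p q : R) :
  2 * (Num.sg q * `|p| - q) * (q - p) + (Num.sg q * `|p| - q) ^+ 2 <=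
  - (q - p) ^+ 2 + 4 * (Num.sg p != Num.sg q)%:R * (q - p) ^+ 2.
Proof.
have n1 : (1 == -1 :> R) = false by rewrite eq_sym lt_eqF//; lra.
have n2 : (-1 == 1 :> R) = false by rewrite eq_sym.
by case: (sgrP p) => p0; case: (sgrP q) => q0;
  rewrite ?(eqxx, eq_sym 0, oner_eq0, oppr_eq0, n1, n2) /=; nra.
Qed.

Lemma sqr_norm2_kaczmarz_le a x z : sphere a ->
  norm2 (kaczmarz x a z - x) ^+ 2 <=
  norm2 (z - x) ^+ 2 - dot a (z - x) ^+ 2
  + 4 * (\1_(wedge x z) a * dot a (z - x) ^+ 2).
Proof.
move=> aS; rewrite sqr_norm2_kaczmarz// -!addrA lerD2l.
have -> : \1_(wedge x z) a = (Num.sg (dot a x) != Num.sg (dot a z))%:R :> R.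
  rewrite indicE; congr (nat_of_bool _)%:R.
  by apply/idP/idP => [/[!inE]-[_ /eqP]|/eqP] //; rewrite inE.
by rewrite mulrA dotBr; exact: sg_step_le.
Qed.

End Pointwise.

(** * Borel measurability *)

Section Measurability.
Context {R : realType} {n : nat}.
Local Notation T := (borel_space R n).

Lemma continuous_borel_measurable (f : 'cV[R]_n -> R) :
  continuous f -> measurable_fun setT (f : T -> R).
Proof.
move=> /continuousP cf; apply: (measurability _ (RGenOpens.measurableE R)).
move=> _ [_ [a [b ->] <-]]; rewrite setTI.
by apply: sub_sigma_algebra; apply: cf; exact: interval_open.
Qed.

Lemma measurable_entry i : measurable_fun setT (fun a : T => a i 0 : R).
Proof. by apply: continuous_borel_measurable; exact: coord_continuous. Qed.

Lemma measurable_dot (f g : T -> 'cV[R]_n) :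
  (forall i, measurable_fun setT (fun a => f a i 0)) ->
  (forall i, measurable_fun setT (fun a => g a i 0)) ->
  measurable_fun setT (fun a : T => dot (f a) (g a)).
Proof.
move=> mf mg; under eq_fun do rewrite dotE.
by apply: measurable_sum => i; exact: measurable_funM.
Qed.

Lemma measurable_dot_cst x : measurable_fun setT (fun a : T => dot a x).
Proof.
apply: measurable_dot => i; [exact: measurable_entry|exact: measurable_cst].
Qed.

Lemma measurable_sphere : measurable (@sphere R n : set T).
Proof.
rewrite sphereE.
have -> : [set a : T | dot a a = 1] = (fun a : T => dot a a) @^-1` [set 1].
  by [].
rewrite -[X in measurable X]setTI; apply: measurable_dot => //;
  by move=> i; exact: measurable_entry.
Qed.

Lemma measurable_sg (f : T -> R) :
  measurable_fun setT f -> measurable_fun setT (fun a => Num.sg (f a)).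
Proof.
apply: measurableT_comp; apply: nondecreasing_measurable => // p q pq.
by case: (sgrP p) => p0; case: (sgrP q) => q0 //; lra.
Qed.

Lemma measurable_wedge (x z : 'cV[R]_n) : measurable (wedge x z : set T).
Proof.
have -> : wedge x z = @sphere R n `&`
   ((fun a : T => Num.sg (dot a x) == Num.sg (dot a z)) @^-1` [set false]).
  apply/seteqP; split=> a [aS] /= ne; split=> //.
    exact/negbTE/eqP.
  by apply/eqP; rewrite ne.
apply: measurableI; first exact: measurable_sphere.
rewrite -[X in measurable X]setTI.
apply: measurable_fun_eqr => //; apply: measurable_sg;
exact: measurable_dot_cst.
Qed.

Lemma measurable_kaczmarz (x z : 'cV[R]_n) :
  measurable_fun setT (fun a : T => norm2 (kaczmarz x a z - x) ^+ 2).
Proof.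
under eq_fun do rewrite sqr_norm2.
have m i : measurable_fun setT (fun a : T => (kaczmarz x a z - x) i 0).
  under eq_fun do rewrite !mxE.
  apply: measurable_funD => //; apply: measurable_funD => //.
  apply: measurable_funM; last exact: measurable_entry.
  apply: measurable_funB; last exact: measurable_dot_cst.
  apply: measurable_funM; first by apply: measurable_sg; exact: measurable_dot_cst.
  by apply: measurableT_comp => //; exact: measurable_dot_cst.
exact: measurable_dot.
Qed.

End Measurability.

(** * Expectations carried by a set of full measure *)

Section FullMeasure.
Context {d} {T : measurableType d} {R : realType}.
Variables (P : probability T R) (D : set T).
Hypothesis mD : measurable D.

Lemma probability_bounded_integrable (f : T -> R) K : measurable_fun D f ->
  (forall a, D a -> `|f a| <= K) -> P.-integrable D (EFin \o f).
Proof.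
move=> mf fK; apply: measurable_bounded_integrable => //.
  by apply: le_lt_trans (probability_le1 P mD) _; rewrite ltry.
exists K; split; first exact: num_real.
by move=> M KM a aD; apply: le_trans (ltW KM); exact: fK.
Qed.

(** Integrability on [D] alone suffices, and on [D] alone the random variables
of interest are bounded. *)
Lemma expectation_full_measure (f : T -> R) : P D = 1%E ->
  measurable_fun setT f -> P.-integrable D (EFin \o f) ->
  'E_P[f]%E = (\int[P]_(a in D) f a)%:E.
Proof.
move=> PD mf fi.
have PDC : P (~` D) = 0%E by rewrite probability_setC// PD subee.
have DE : setT `\` ~` D = D by rewrite setTD setCK.
have fiT : P.-integrable setT (EFin \o f).
  apply/(negligible_integrable (measurableC mD) measurableT _ PDC).
    exact/measurable_EFinP.
  by rewrite DE.
rewrite /Rintegral fineK; last exact: integrable_fin_num.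
by rewrite unlock (negligible_integral (measurableC mD) measurableT fiT PDC) DE.
Qed.

Lemma Rintegral_sum (I : Type) (r : seq I) (f : I -> T -> R) :
  (forall i, P.-integrable D (EFin \o f i)) ->
  P.-integrable D (EFin \o (fun a => \sum_(i <- r) f i a)) /\
  \int[P]_(a in D) (\sum_(i <- r) f i a) =
  \sum_(i <- r) \int[P]_(a in D) f i a.
Proof.
move=> fi.
have sumE : EFin \o (fun a => \sum_(i <- r) f i a) =
    (fun a => \sum_(i <- r) (f i a)%:E)%E.
  by apply/funext => a /=; rewrite sumEFin.
split; first by rewrite sumE; apply: integrable_sum => // i _; exact: fi.
rewrite {1}/Rintegral [X in fine (integral _ _ X)]sumE integral_sum//.
by rewrite sum_fine// => i _; apply: integrable_fin_num => //; exact: fi.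
Qed.

End FullMeasure.

(** The expectation in [expectation_mx] is entrywise, so this is linearity of
the integral applied to the expansion of the form in the entries of [M]. *)
Lemma dot_expectation_mx (R : realType) (n : nat)
    (mu : probability (borel_space R n) R) (D : set (borel_space R n))
    (M : borel_space R n -> 'M[R]_n) K (u : 'cV[R]_n) :
  measurable D -> mu D = 1%E ->
  (forall i j, measurable_fun setT (fun a => M a i j)) ->
  (forall a i j, D a -> `|M a i j| <= K) ->
  mu.-integrable D (EFin \o (fun a => dot u (M a *m u))) /\
  dot u (expectation_mx mu M *m u) = \int[mu]_(a in D) dot u (M a *m u).
Proof.
move=> mD muD mM MK.
have Mi i j : mu.-integrable D (EFin \o (fun a => M a i j)).
  apply: (@probability_bounded_integrable _ _ _ mu D mD _ K).
    exact: measurable_funTS.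
  by move=> a; exact: MK.
have Mci i j :
    mu.-integrable D (EFin \o (fun a => u i 0 * u j 0 * M a i j)).
  exact: (integrableZl mD (u i 0 * u j 0) (Mi i j)).
under [fun a => dot u (M a *m u)]eq_fun do rewrite dot_mulmxE.
have si i := Rintegral_sum mu D mD _ (index_enum _) _ (Mci i).
have [s1 s2] := Rintegral_sum mu D mD _ (index_enum _) _ (fun i => (si i).1).
split=> //.
rewrite s2 dot_mulmxE; apply: eq_bigr => i _; rewrite (si i).2.
apply: eq_bigr => j _.
by rewrite RintegralZl// mxE (expectation_full_measure _ _ mD).
Qed.

(** * The expected squared error *)

Theorem lemma2p1 (R : realType) (n : nat) (x z : 'cV[R]_n)
    (mu : probability (borel_space R n) R)
    (mu_sphere : mu (@sphere R n) = 1%E) :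
  ('E_mu[fun a => (norm2 (kaczmarz x a z - x) ^+ 2)%R] <=
   ((1 - lambda_min
           (expectation_mx mu (fun a => a *m a^T)
            - 4 *: expectation_mx mu
                (fun a => \1_(wedge x z) a *: (a *m a^T))))
    * norm2 (z - x) ^+ 2)%R%:E)%E.
Proof.
have mS : measurable (@sphere R n : set (borel_space R n)) := measurable_sphere.
set d := z - x; set W := wedge x z.
pose M1 (a : borel_space R n) := a *m a^T.
pose M2 (a : borel_space R n) := \1_W a *: (a *m a^T).
have M1E a i j : M1 a i j = a i 0 * a j 0 by rewrite mxE big_ord1 mxE.
have M2E a i j : M2 a i j = \1_W a * (a i 0 * a j 0) by rewrite mxE M1E.
have mM1 i j : measurable_fun setT (fun a => M1 a i j).
  under eq_fun do rewrite M1E.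
  by apply: measurable_funM; exact: measurable_entry.
have mM2 i j : measurable_fun setT (fun a => M2 a i j).
  under eq_fun do rewrite M2E -M1E.
  by apply: measurable_funM => //; apply: measurable_indic; exact: measurable_wedge.
have M1K a i j : sphere a -> `|M1 a i j| <= 1.
  by move=> aS; rewrite M1E normrM mulr_ile1// sphere_entry_le1.
have M2K a i j : sphere a -> `|M2 a i j| <= 1.
  move=> aS; rewrite M2E -M1E normrM mulr_ile1// ?M1K// indicE.
  by case: (_ \in _); rewrite ?normr1 ?normr0.
have [i1 e1] := dot_expectation_mx R n mu _ _ _ d mS mu_sphere mM1 M1K.
have [i2 e2] := dot_expectation_mx R n mu _ _ _ d mS mu_sphere mM2 M2K.
set A := expectation_mx _ _ - _.
have As : A^T = A.
  apply/matrixP => i j; rewrite !mxE; congr (fine _ - 4 * fine _);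
  congr expectation.body; apply/funext => a.
    by rewrite -/(M1 a) !M1E mulrC.
  by rewrite -/(M2 a) !M2E (mulrC (a i 0)).
have dAd : dot d (A *m d) = \int[mu]_(a in @sphere R n) dot d (M1 a *m d)
    - 4 * \int[mu]_(a in @sphere R n) dot d (M2 a *m d).
  by rewrite -e1 -e2 mulmxBl -scalemxAl dotBr dotZr.
pose G a := norm2 d ^+ 2 - dot d (M1 a *m d) + 4 * dot d (M2 a *m d).
have i3 := probability_bounded_integrable mu _ mS (fun=> norm2 d ^+ 2)
  `|norm2 d ^+ 2| (measurable_cst _) (fun a _ => lexx _).
have i4 := integrableZl mS 4 i2.
have i5 := integrableB mS i3 i1.
have iG : mu.-integrable (@sphere R n) (EFin \o G) := integrableD mS i5 i4.
have FG a : sphere a -> norm2 (kaczmarz x a z - x) ^+ 2 <= G a.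
  move=> aS; apply: le_trans (sqr_norm2_kaczmarz_le _ _ _ aS) _.
  by rewrite /G /M2 -scalemxAl dotZr dot_outer.
have iF : mu.-integrable (@sphere R n)
    (EFin \o (fun a => norm2 (kaczmarz x a z - x) ^+ 2)).
  apply: (le_integrable mS _ _ iG).
    by apply/measurable_EFinP/measurable_funTS; exact: measurable_kaczmarz.
  move=> a aS /=; rewrite lee_fin ger0_norm ?sqr_ge0//.
  exact: le_trans (FG _ aS) (ler_norm _).
rewrite (expectation_full_measure mu _ mS _ mu_sphere (measurable_kaczmarz x z))// lee_fin.
apply: le_trans (le_Rintegral mS iF iG FG) _.
rewrite RintegralD// RintegralB// RintegralZl// Rintegral_cst//.
have -> : fine (mu (@sphere R n)) = 1 by rewrite mu_sphere.
rewrite mulr1 mulrBl mul1r.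
have := lambda_min_quad_le A d As; rewrite dAd -sqr_norm2; lra.
Qed.
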